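(* Let $\mathbb{F}$ be a field and let $\mathcal{A}$ be an associative finite-dimensional unital $\mathbb{F}$-algebra. Put $d=\dim_{\mathbb{F}}\mathcal{A}$ and $m=m(\mathcal{A})$, and assume $m>1$ and $|\mathbb{F}|>m$. Then for every integer $k\ge 0$, $$l(\mathcal{A})\le \max\left\{k(m-1),\ \frac{d}{k+1}+k-1\right\}.$$
   Context: For a subset $\mathcal{S}\subseteq\mathcal{A}$ and $i\ge 0$, $\mathcal{L}_i(\mathcal{S})$ is the $\mathbb{F}$-linear span of all products of at most $i$ elements of $\mathcal{S}$ (repetitions allowed; the empty product is $1_{\mathcal{A}}$), and $\mathcal{L}(\mathcal{S})=\bigcup_{i\ge 0}\mathcal{L}_i(\mathcal{S})$ is the unital subalgebra generated by $\mathcal{S}$. $\mathcal{S}$ is a generating set of $\mathcal{A}$ if $\mathcal{L}(\mathcal{S})=\mathcal{A}$. The length $l(\mathcal{S})$ of $\mathcal{S}$ is the smallest integer $k\ge 0$ with $\mathcal{L}(\mathcal{S})=\mathcal{L}_k(\mathcal{S})$. The length of the algebra is $l(\mathcal{A})=\max\{l(\mathcal{S}) : \mathcal{S}\text{ is a generating set of }\mathcal{A}\}$. For $a\in\mathcal{A}$, $\deg a$ is the degree of the minimal polynomial of $a$ over $\mathbb{F}$, and $m(\mathcal{A})=\max\{\deg a : a\in\mathcal{A}\}$. The field $\mathbb{F}$ may be infinite, in which case $|\mathbb{F}|>m$ holds automatically. *)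

(* Defs.v *)
From HB Require Import structures.
From mathcomp Require Import all_boot all_order all_algebra all_field.
From mathcomp Require Import boolp classical_sets cardinality.

Set Implicit Arguments.
Unset Strict Implicit.
Unset Printing Implicit Defensive.

Import Order.TTheory GRing.Theory Num.Theory.

Local Open Scope classical_set_scope.
Local Open Scope ring_scope.

(* The span of an arbitrary, possibly infinite, subset: an element lies in it
   iff it lies in the span of finitely many members of the subset. *)
Definition lin_span (F : fieldType) (A : falgType F) (X : set A) : set A :=
  [set a | exists2 s : seq A, [set` s] `<=` X & a \in <<s>>%VS].

Definition words (F : fieldType) (A : falgType F) (S : set A) (i : nat) :
    set A :=
  [set a | exists w : seq A,
     [/\ (size w <= i)%N, [set` w] `<=` S & a = \prod_(x <- w) x]].

Definition Lspan (F : fieldType) (A : falgType F) (S : set A) (i : nat) :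
    set A :=
  lin_span (words S i).

Definition Lgen (F : fieldType) (A : falgType F) (S : set A) : set A :=
  \bigcup_i Lspan S i.

Definition generating (F : fieldType) (A : falgType F) (S : set A) : Prop :=
  Lgen S = [set: A].

Section Existence.
Variables (F : fieldType) (A : falgType F).
Implicit Types (S X : set A) (a : A).

Lemma lin_span_vspace X :
  exists2 s : seq A, [set` s] `<=` X & lin_span X = [set` <<s>>%VS].
Proof.
pose P n := `[< exists2 s : seq A, [set` s] `<=` X & \dim <<s>>%VS = n >].
have exP : exists n, P n by exists (\dim <<Nil A>>%VS); apply/asboolP; exists [::].
have ubP n : P n -> (n <= \dim {:A})%N.
  by move=> /asboolP[s _ <-]; apply/dimvS/subvf.
case: (ex_maxnP exP ubP) => n /asboolP[s sX ds] maxn.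
exists s => //; apply/seteqP; split=> a /=; last by exists s.
case=> t tX at_.
have le_s : (<<s>> <= <<t ++ s>>)%VS by rewrite span_cat addvSr.
have -> : <<s>>%VS = <<t ++ s>>%VS.
  apply/eqP; rewrite eqEdim le_s ds; apply: maxn; apply/asboolP.
  exists (t ++ s) => // x /=; rewrite mem_cat => /orP[]; [exact: tX|exact: sX].
by rewrite span_cat; apply: (subvP (addvSl _ _)).
Qed.

Lemma lin_spanS X Y : X `<=` Y -> lin_span X `<=` lin_span Y.
Proof. by move=> XY a [s sX sa]; exists s => // x /sX /XY. Qed.

Lemma lin_span_sub X (V : {vspace A}) :
  X `<=` [set` V] -> lin_span X `<=` [set` V].
Proof. by move=> XV a [s sX sa]; apply: (subvP _ _ sa); apply/span_subvP => x /sX/XV. Qed.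

Lemma sub_lin_span X : X `<=` lin_span X.
Proof.
move=> a Xa; exists [:: a]; last by rewrite memv_span ?mem_head.
by move=> x /=; rewrite inE => /eqP ->.
Qed.

Lemma wordsS S i j : (i <= j)%N -> words S i `<=` words S j.
Proof. by move=> ij a [w [wi wS ->]]; exists w; split=> //; apply: leq_trans ij. Qed.

Lemma LspanS S i j : (i <= j)%N -> Lspan S i `<=` Lspan S j.
Proof. by move=> ij; apply/lin_spanS/wordsS. Qed.

Lemma Lspan_stableS S i : Lspan S i.+1 = Lspan S i -> Lspan S i.+2 = Lspan S i.+1.
Proof.
move=> e; apply/seteqP; split; last exact: LspanS.
have [s _ es] := lin_span_vspace (words S i.+1).
rewrite /Lspan es; apply: lin_span_sub => a [[|x w] [wi wS ->]].
  by rewrite -es; apply: sub_lin_span; exists [::].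
rewrite big_cons.
have [t tS wt] : Lspan S i (\prod_(y <- w) y).
  rewrite -e; apply: sub_lin_span; exists w; split=> // y yw.
  by apply: wS; rewrite /= inE; apply/orP; right.
rewrite -es; exists [seq x * y | y <- t].
  move=> _ /mapP[y /tS[v [vi vS ->]] ->]; exists (x :: v).
  rewrite big_cons; split=> // z /=; rewrite inE => /orP[/eqP ->|/vS//].
  by apply: wS; rewrite /= mem_head.
have -> : x * \prod_(y <- w) y = amull x (\prod_(y <- w) y) by rewrite lfunE.
have -> : [seq x * y | y <- t] = map (amull x) t.
  by apply: eq_map => y; rewrite lfunE.
by rewrite -limg_span memv_img.
Qed.

Lemma Lspan_stable S i j :
  Lspan S i.+1 = Lspan S i -> (i <= j)%N -> Lspan S j = Lspan S i.
Proof.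
move=> e /subnK <-; elim: (j - i)%N => [//|n IH].
rewrite addSn -[RHS]IH; elim: n {IH} => [//|n IH].
by rewrite addSn; apply: Lspan_stableS; rewrite -addSn.
Qed.

Lemma Lspan_dim S : exists2 k, (k <= \dim {:A})%N & Lgen S = Lspan S k.
Proof.
suff [k kd e] : exists2 k, (k <= \dim {:A})%N & Lspan S k.+1 = Lspan S k.
  exists k => //; apply/seteqP; split=> a; last by exists k.
  case=> j _ aj; have [jk|/ltnW kj] := leqP j k; first exact: LspanS aj.
  by rewrite -(Lspan_stable e kj).
have [//|nstab] := pselect (exists2 k, (k <= \dim {:A})%N & Lspan S k.+1 = Lspan S k).
suff /(_ (\dim {:A}).+1 (leqnn _)) [V _] : forall k, (k <= (\dim {:A}).+1)%N ->
    exists2 V : {vspace A}, Lspan S k = [set` V] & (k <= \dim V)%N.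
  by rewrite ltnNge dimvS ?subvf.
elim=> [_|k IH kd].
  by have [s _ es] := lin_span_vspace (words S 0); exists <<s>>%VS.
have [V eV dV] := IH (ltnW kd).
have [s _ es] := lin_span_vspace (words S k.+1); exists <<s>>%VS => //.
have sub : (V <= <<s>>)%VS.
  apply/subvP => x xV; suff : [set` <<s>>%VS] x by [].
  by rewrite -es; apply: (@LspanS S k) => //; rewrite eV.
rewrite (leq_ltn_trans dV) // ltn_neqAle dimvS // andbT.
apply/negP => /eqP dVs; apply: nstab; exists k => //.
have eVs : V = <<s>>%VS by apply/eqP; rewrite eqEdim sub dVs leqnn.
by rewrite eV eVs.
Qed.

Lemma set_length_ex S : exists k, `[< Lgen S = Lspan S k >].
Proof. by have [k _ e] := Lspan_dim S; exists k; apply/asboolP. Qed.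

Lemma min_poly_ex a :
  exists p : {poly F}, `[< [/\ p \is monic, horner_alg a p = 0 &
    forall q : {poly F}, q \is monic -> horner_alg a q = 0 ->
      (size p <= size q)%N] >].
Proof.
pose P n := `[< exists p : {poly F},
  [/\ p \is monic, horner_alg a p = 0 & size p = n] >].
suff exP : exists n, P n.
  case: (ex_minnP exP) => n /asboolP[p [pm pa pn]] minn.
  exists p; apply/asboolP; split=> // q qm qa.
  by rewrite pn; apply: minn; apply/asboolP; exists q.
pose d := \dim {:A}.
pose X := [tuple a ^+ i | i < d.+1].
have nfX : ~~ free X.
  apply/negP; rewrite /free size_tuple => /eqP dX.
  by have := dimvS (subvf <<X>>%VS); rewrite dX ltnn.
have [k k0 [i ki]] : exists2 k : 'I_d.+1 -> F,
    \sum_(i < d.+1) k i *: X`_i = 0 & exists i, k i != 0.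
  apply: contrapT => nk; move/negP: nfX; apply; apply/freeP => k k0 i.
  by apply/eqP/negPn/negP => ki; apply: nk; exists k => //; exists i.
pose p := \poly_(j < d.+1) k (inord j).
have pi : p`_i != 0 by rewrite coef_poly ltn_ord inord_val.
have p0 : p != 0 by apply: contraNneq pi => ->; rewrite coef0.
have pa : horner_alg a p = 0.
  rewrite -k0 /p poly_def raddf_sum /=; apply: eq_bigr => j _.
  rewrite linearZ /= rmorphXn /= horner_algX inord_val mulr_algl; congr (_ *: _).
  by rewrite -[LHS](tnth_mktuple (fun i => a ^+ i)) (tnth_nth 0).
exists (size ((lead_coef p)^-1 *: p)); apply/asboolP.
exists ((lead_coef p)^-1 *: p); split=> //.
  by rewrite monicE lead_coefZ mulVf ?lead_coef_eq0.
by rewrite linearZ /= pa mulr0.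
Qed.

End Existence.

Definition set_length (F : fieldType) (A : falgType F) (S : set A) : nat :=
  ex_minn (set_length_ex S).

(* The monic annihilator of least degree; min_polyP below shows that it divides
   every annihilating polynomial, so the choice is unique. *)
Definition min_poly (F : fieldType) (A : falgType F) (a : A) : {poly F} :=
  xchoose (min_poly_ex a).

Definition deg (F : fieldType) (A : falgType F) (a : A) : nat :=
  (size (min_poly a)).-1.

Section Bounds.
Variables (F : fieldType) (A : falgType F).
Implicit Types (S : set A) (a : A).

Lemma min_polyP a :
  [/\ min_poly a \is monic, horner_alg a (min_poly a) = 0 &
    forall q : {poly F}, horner_alg a q = 0 -> min_poly a %| q].
Proof.
have /asboolP[pm pa pmin] := xchooseP (min_poly_ex a).
rewrite -/(min_poly a) in pm pa pmin *; split=> // q qa.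
apply: contraT => r0; set p := min_poly a in pm pa pmin r0 *.
have rn0 : q %% p != 0 by [].
have ra : horner_alg a (q %% p) = 0.
  have := qa; rewrite {1}(divp_eq q p) rmorphD rmorphM /= pa mulr0 add0r.
  by [].
have := pmin ((lead_coef (q %% p))^-1 *: (q %% p)).
rewrite monicE lead_coefZ mulVf ?lead_coef_eq0 // eqxx => /(_ isT).
rewrite linearZ /= ra mulr0 => /(_ erefl).
rewrite size_scale ?invr_eq0 ?lead_coef_eq0 // leqNgt ltn_modp.
by rewrite monic_neq0.
Qed.

Lemma deg_le_dim a : (deg a <= \dim {:A})%N.
Proof.
rewrite /deg; set p := min_poly a; have [pm pa pdvd] := min_polyP a.
pose n := (size p).-1.
pose X := [tuple a ^+ i | i < n].
suff /eqP : free X by rewrite size_tuple -/n => <-; apply/dimvS/subvf.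
apply/freeP => k k0 i.
pose q := \poly_(j < n) oapp k 0 (insub j).
have qa : horner_alg a q = 0.
  rewrite -k0 /q poly_def raddf_sum /=; apply: eq_bigr => j _.
  rewrite linearZ /= rmorphXn /= horner_algX valK /= mulr_algl; congr (_ *: _).
  by rewrite -[LHS](tnth_mktuple (fun i => a ^+ i)) (tnth_nth 0).
have q0 : q = 0.
  apply/eqP; apply: contraT => qn0; have := dvdp_leq qn0 (pdvd _ qa).
  have p_gt0 : (0 < size p)%N by rewrite size_poly_gt0 monic_neq0.
  have := size_poly n (fun j => oapp k 0 (insub j)); rewrite -/q => h1 h2.
  by have := leq_trans h2 h1; rewrite -/p /n; case: (size p) p_gt0 => //= s _; rewrite ltnn.
have := coef_poly n (fun j => oapp k 0 (insub j)) i.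
by rewrite -/q q0 coef0 ltn_ord valK.
Qed.

Lemma max_deg_ex : exists n, `[< exists a : A, deg a = n >].
Proof. by exists (deg (0 : A)); apply/asboolP; exists 0. Qed.

Lemma max_deg_bound n : `[< exists a : A, deg a = n >] -> (n <= \dim {:A})%N.
Proof. by move=> /asboolP[a <-]; apply: deg_le_dim. Qed.

Lemma generatingT : generating [set: A].
Proof.
apply/seteqP; split=> // a _; exists 1%N => //; apply: sub_lin_span.
by exists [:: a]; rewrite big_seq1.
Qed.

Lemma alg_length_ex :
  exists n, `[< exists2 S : set A, generating S & set_length S = n >].
Proof.
exists (set_length [set: A]); apply/asboolP; exists setT => //.
exact: generatingT.
Qed.

Lemma alg_length_bound n :
  `[< exists2 S : set A, generating S & set_length S = n >] ->
  (n <= \dim {:A})%N.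
Proof.
move=> /asboolP[S _ <-]; rewrite /set_length; case: ex_minnP => k _ kmin.
by have [j jd e] := Lspan_dim S; apply: leq_trans jd; apply: kmin; apply/asboolP.
Qed.

End Bounds.

Definition alg_length (F : fieldType) (A : falgType F) : nat :=
  ex_maxn (@alg_length_ex F A) (@alg_length_bound F A).

Definition max_deg (F : fieldType) (A : falgType F) : nat :=
  ex_maxn (@max_deg_ex F A) (@max_deg_bound F A).

(* Main.v *)
(** Let w be a word of length l over the generators lying outside L_(l-1), and
    lexicographically least among such words.  No factor of w is a linear
    combination of words that are smaller in the degree-lexicographic order, so
    the distinct factors of w are linearly independent and there are at most d
    of them.  The factors are counted by a finite Morse-Hedlund argument: if w
    has at most min(j, k, l - j) factors of length j and l > k(m - 1), then w
    contains a factor U^(m-1) c with c the first letter of U; otherwise w has at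
    least sum_j min(j + 1, k + 1, l - j + 1) = (k + 1)(l - k + 1) factors when
    2k <= l, and the case 2k > l follows by exchanging k and l - k.

    A factor U^(m-1) c is impossible: the algebra element (U + t c)^m is a
    combination of lower powers for all t, and |F| > m, so the coefficient of t,
    sum_i U^i c U^(m-1-i), lies in the span of the words shorter than
    U^(m-1) c.  Writing U = c u, T = u c, we have U^(m-1) c = c T^(m-1), and this
    word is the lexicographically largest one either in that sum or in the
    analogous sum for T, unless u c = c u, in which case it contains c^m. *)
Require Import Defs.
From mathcomp Require Import all_boot all_order all_algebra all_field.
From mathcomp Require Import boolp classical_sets functions cardinality.
From mathcomp Require Import zify.

Set Implicit Arguments.
Unset Strict Implicit.
Unset Printing Implicit Defensive.

(** * Factors of finite words *)

Section Factors.
Variable T : eqType.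
Implicit Types (w u : seq T).

Definition factors j w := [seq take j (drop i w) | i <- iota 0 (size w - j).+1].

Lemma factorsP j w v :
  reflect (exists2 i, i <= size w - j & v = take j (drop i w)) (v \in factors j w).
Proof.
apply: (iffP mapP) => [[i]|[i iw ->]].
  by rewrite mem_iota add0n ltnS => iw ->; exists i.
by exists i; rewrite // mem_iota ltnS.
Qed.

Lemma size_factor j w v : j <= size w -> v \in factors j w -> size v = j.
Proof. by move=> jw /factorsP[i iw ->]; rewrite size_takel // size_drop; lia. Qed.

Lemma factors_cons j x w :
  j <= size w -> factors j (x :: w) = take j (x :: w) :: factors j w.
Proof.
move=> jw; rewrite /factors /= subSn //= drop0; congr (_ :: _).
by rewrite (iotaDl 1) /= -map_comp.
Qed.

Definition complexity j w := size (undup (factors j w)).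

Lemma take_drop_cons x0 i j w : i < size w ->
  take j.+1 (drop i w) = nth x0 w i :: take j (drop i.+1 w).
Proof. by move=> iw; rewrite (drop_nth x0 iw). Qed.

Lemma uniq_map_inj_in (T' : eqType) (f : T -> T') s :
  uniq (map f s) -> {in s &, injective f}.
Proof.
elim: s => //= x s IH /andP[xs us] y z; rewrite !inE.
move=> /orP[/eqP->|ys] /orP[/eqP->|zs] // e; last exact: IH.
- by rewrite e map_f in xs.
- by rewrite -e map_f in xs.
Qed.

End Factors.

(** * Few factors of one length force a repetition *)

Section Periodicity.
Variable T : eqType.
Implicit Types (w u : seq T).

(* If the prefix of length j does not recur, it is dropped with its first letter
   in an induction on w; if it does, complexity is nondecreasing up to j + 1, and
   an equality makes every factor extend uniquely to the left. *)
Definition prefix_recurs j w :=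
  exists2 b, 0 < b <= size w - j & take j (drop b w) = take j w.

Lemma prefix_recursW i j w : i <= j -> prefix_recurs j w -> prefix_recurs i w.
Proof.
move=> ij [b bw e]; exists b; first by lia.
by rewrite -(take_takel _ ij) e take_takel.
Qed.

(** Since the prefix recurs, every factor has an occurrence at a positive position, hence a letter
    on its left. *)
Lemma factors_behead j w : j < size w -> prefix_recurs j w ->
  {subset factors j w <= map behead (factors j.+1 w)}.
Proof.
case: w => // x0 w0; set w := x0 :: w0 => jw [b /andP[b0 bw] e] v /factorsP[i iw ->].
have [i' iw' ->] : exists2 i', 0 < i' <= size w - j & take j (drop i w) = take j (drop i' w).
  case: (posnP i) => [->|i0]; last by exists i; rewrite ?i0.
  by exists b; rewrite ?b0 ?bw // e drop0.
apply/mapP; exists (take j.+1 (drop i'.-1 w)).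
  by apply/factorsP; exists i'.-1 => //; lia.
rewrite (@take_drop_cons _ x0); last by lia.
by rewrite prednK //; lia.
Qed.

(** Deleting the first letter maps the factors of length [j.+1] onto those of length [j]; equality
    means that each factor has only one left extension. *)
Lemma complexity_behead j w : j < size w -> prefix_recurs j w ->
  complexity j w <= complexity j.+1 w ?= iff
    uniq (map behead (undup (factors j.+1 w))).
Proof.
move=> jw rec; have sub := factors_behead jw rec.
set s := map behead _.
have sub' : {subset undup (factors j w) <= s}.
  by move=> v; rewrite mem_undup => /sub /mapP[v' v'w ->]; apply: map_f; rewrite mem_undup.
have sub2 : {subset s <= undup (factors j w)}.
  move=> v /mapP[v']; rewrite mem_undup => /factorsP[i iw ->] ->.
  rewrite mem_undup; apply/factorsP; exists i.+1; first by lia.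
  case: w jw iw {rec sub s sub'} => // x0 w jw iw.
  by rewrite (@take_drop_cons _ x0) //; lia.
have -> : complexity j.+1 w = size s by rewrite size_map.
split; first by apply: uniq_leq_size => //; apply: undup_uniq.
have e : undup (factors j w) =i s by move=> v; apply/idP/idP; [apply: sub'|apply: sub2].
apply/eqP/idP => [es|us].
  by rewrite (uniq_size_uniq (undup_uniq _) e) -es.
by apply/eqP; rewrite -(uniq_size_uniq us) ?undup_uniq // => v; rewrite e.
Qed.

Lemma complexity_gt0 j w : 0 < complexity j w.
Proof. by rewrite lt0n size_eq0; apply/eqP => /undup_nil. Qed.

(** Strict growth of the complexity from length 0 to length [j] would give at least [j.+1] factors.
    At a length [i < j] without growth, the next [i] letters determine the letter before them. *)
Lemma left_determined j w : j < size w -> prefix_recurs j w -> complexity j w <= j ->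
  exists2 i, i < j & forall a b x0, a <= size w - i.+1 -> b <= size w - i.+1 ->
    take i (drop a.+1 w) = take i (drop b.+1 w) -> nth x0 w a = nth x0 w b.
Proof.
move=> jw rec cj.
have [i ij ei] : exists2 i, i < j & complexity i w == complexity i.+1 w.
  case: (boolP (has (fun i => complexity i w == complexity i.+1 w) (iota 0 j))).
    by move=> /hasP[i]; rewrite mem_iota => /andP[_ ij] e; exists i.
  rewrite -all_predC => /allP h; suff : j.+1 <= complexity j w by rewrite ltnNge cj.
  elim: {-2}j (leqnn j) => [_|i IH ij]; first exact: complexity_gt0.
  apply: leq_ltn_trans (IH (ltnW ij)) _.
  have -> := ltn_leqif (complexity_behead (ltn_trans ij jw) (prefix_recursW (ltnW ij) rec)).
  have := h i; rewrite mem_iota /= => /(_ ij) /negbTE.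
  by have [_ ->] := complexity_behead (ltn_trans ij jw) (prefix_recursW (ltnW ij) rec) => ->.
exists i => // a b x0 aw bw e.
have iw := ltn_trans ij jw.
move: ei; have [_ ->] := complexity_behead iw (prefix_recursW (ltnW ij) rec).
move=> /uniq_map_inj_in inj.
have mem c : c <= size w - i.+1 -> take i.+1 (drop c w) \in undup (factors i.+1 w).
  by move=> cw; rewrite mem_undup; apply/factorsP; exists c.
have := inj _ _ (mem _ aw) (mem _ bw).
by rewrite !(@take_drop_cons _ x0) //=; [move=> /(_ e) [] | lia | lia].
Qed.

(** Agreement at [a] and [b] spreads leftwards one letter at a time, each letter being determined by
    those that follow; the prefix of length [j + b] gets period [b - a]. *)
Lemma period_left j w a b : a < b <= size w - j -> j < size w ->
  prefix_recurs j w -> complexity j w <= j ->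
  take j (drop a w) = take j (drop b w) ->
  take (j + a) w = take (j + a) (drop (b - a) w).
Proof.
move=> /andP[ab bw] jw rec cj.
have [i ij det] := left_determined jw rec cj.
have [x0 _] : exists x0 : T, True by case: w jw {bw rec cj det} => // x0; exists x0.
suff : forall n, n <= a -> take j (drop a w) = take j (drop b w) ->
    take (j + n) (drop (a - n) w) = take (j + n) (drop (b - n) w).
  by move=> /(_ a (leqnn a)) h /h; rewrite subnn drop0.
elim=> [|n IH] na e; first by rewrite addn0 !subn0.
have {}IH := IH (ltnW na) e.
have aS : a - n = (a - n.+1).+1 by lia.
have bS : b - n = (b - n.+1).+1 by lia.
rewrite addnS !(@take_drop_cons _ x0); [|lia..].
rewrite -aS -bS IH; congr (_ :: _); apply: det; [lia..|].
by rewrite -aS -bS -(take_takel _ (_ : i <= j + n)) ?IH ?take_takel //; lia.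
Qed.

Lemma take_period q r w x0 : q * r < size w ->
  take ((q * r).+1 - q) w = take ((q * r).+1 - q) (drop q w) ->
  take (q * r).+1 w = flatten (nseq r (take q w)) ++ [:: nth x0 w 0].
Proof.
move=> qr per.
suff H i : i <= r -> take (q * i).+1 w = flatten (nseq i (take q w)) ++ [:: nth x0 w 0].
  exact: H.
elim: i => [_|i IH ir].
  by rewrite muln0 /=; case: w qr {per} => //= y w _; rewrite take0.
rewrite mulnS -addnS takeD /= -catA -IH //; last exact: ltnW.
have le : (q * i).+1 <= (q * r).+1 - q.
  by have := leq_mul (leqnn q) ir; rewrite mulnS; lia.
by rewrite -(take_takel _ le) -per take_takel.
Qed.

Lemma periodic_factor n k j w : 0 < n -> k * n < size w -> j <= size w ->
  complexity j w <= j -> complexity j w <= k -> complexity j w <= size w - j ->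
  exists p c u s, w = p ++ flatten (nseq n (c :: u)) ++ c :: s.
Proof.
move=> n0; elim: w k => [|x w IH] k //.
move=> kw jw cj ck cw.
have c0 := complexity_gt0 j (x :: w).
have {jw} jw : j <= size w by move: cw => /=; lia.
(* If the prefix of length [j] does not recur, dropping the first letter loses exactly one factor,
   so the hypotheses survive with [k.-1]. *)
case: (boolP (take j (x :: w) \in factors j w)) => [recb|nrec]; last first.
  have cS : complexity j (x :: w) = (complexity j w).+1.
    by rewrite {1}/complexity factors_cons //= (negbTE nrec).
  rewrite cS in cj ck cw.
  have kw' : k.-1 * n < size w by move: kw ck => /=; case: k => //= k; nia.
  have [|||p [c [u [s ->]]]] := IH k.-1 kw' jw; [lia | lia | by move: cw => /=; lia |].
  by exists (x :: p), c, u, s.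
set w' := x :: w in kw cj ck cw c0 *.
have jw' : j < size w' by [].
have rec : prefix_recurs j w'.
  by move/factorsP: recb => [i iw e]; exists i.+1; rewrite //= ?e //; lia.
set s := complexity j w' in cj ck cw c0 *.
(* The last [s.+1] positions start at [o], and two of them carry the same factor; taking them late
   makes the periodic prefix long. *)
pose o := size w' - j - s.
have [a [b [ao ab bw e]]] : exists a b, [/\ o <= a, a < b, b <= size w' - j &
    take j (drop a w') = take j (drop b w')].
  have nu : ~~ uniq [seq take j (drop i w') | i <- iota o s.+1].
    apply/negP => us; suff : s.+1 <= s by rewrite ltnn.
    rewrite -{1}(size_iota o s.+1) -(size_map (fun i => take j (drop i w'))).
    apply: uniq_leq_size => // v /mapP[i]; rewrite mem_iota => io ->.
    by rewrite mem_undup; apply/factorsP; exists i => //; lia.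
  move: nu => /(uniqPn [::])[a [b [ab]]]; rewrite size_map size_iota => bs.
  rewrite !(nth_map 0) ?size_iota ?(ltn_trans ab) // !nth_iota ?(ltn_trans ab) // => e.
  exists (o + a), (o + b); split => //; lia.
have ab' : a < b <= size w' - j by rewrite ab.
have per := period_left ab' jw' rec cj e.
set q := b - a in per *.
have q0 : 0 < q by rewrite subn_gt0.
have qs : q <= s by rewrite /q; lia.
(* As [s * n < size w'], [q <= s] and [0 < n], one has [q * n <= s * n - (s - q) < size w' - s + q
   <= j + b]. *)
have long : q * n < j + b.
  have : s * n <= k * n by rewrite leq_mul2r ck orbT.
  rewrite /o in ao; rewrite /q in qs *; nia.
have le : (q * n).+1 - q <= j + a by rewrite /q in long *; lia.
have eqv : take (q * n).+1 w' = flatten (nseq n (take q w')) ++ [:: x].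
  rewrite (take_period x) //; first lia.
  by rewrite -(take_takel _ le) per take_takel.
exists [::], x, (take q.-1 w), (drop (q * n).+1 w').
have e1 : take q w' = x :: take q.-1 w by rewrite -{1}(prednK q0).
by rewrite -{1}(cat_take_drop (q * n).+1 w') eqv e1 -catA.
Qed.

End Periodicity.

(* Removing the two extreme terms turns (k + 1, l + 2) into (k, l). *)
Lemma sum_minn k l : 2 * k <= l ->
  \sum_(j < l.+1) minn (minn j.+1 k.+1) (l - j).+1 = k.+1 * (l - k).+1.
Proof.
elim: k l => [|k IH] l kl.
  rewrite mul1n subn0 (eq_bigr (fun=> 1)) => [|j _]; last by lia.
  by rewrite sum1_card card_ord.
case: l kl => [|[|l]] kl; [lia..|].
rewrite big_ord_recl big_ord_recr /=.
rewrite (eq_bigr (fun j : 'I_l.+1 => 1 + minn (minn j.+1 k.+1) (l - j).+1)); last first.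
  by move=> j _; rewrite /bump /=; have := ltn_ord j; lia.
rewrite big_split /= IH; last by lia.
rewrite sum1_card card_ord /bump /=; nia.
Qed.

(** * The degree-lexicographic order *)

Section WordCode.
Variable n : nat.
Implicit Types u v w : seq 'I_n.

(* Bijective base-n numeration, so that the order of codes is the
   degree-lexicographic order on words. *)
Definition code u := foldl (fun c (i : 'I_n) => c * n + i.+1) 0 u.

Lemma code_rcons u i : code (rcons u i) = code u * n + i.+1.
Proof. exact: foldl_rcons. Qed.

Lemma code_cat u v : code (u ++ v) = code u * n ^ size v + code v.
Proof.
elim/last_ind: v => [|v i IH]; first by rewrite cats0 muln1 addn0.
by rewrite -rcons_cat !code_rcons IH size_rcons expnS; nia.
Qed.

Lemma size_le_code u : size u <= code u.
Proof.
elim/last_ind: u => // u i IH; rewrite size_rcons code_rcons.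
have n0 : 0 < n by have := ltn_ord i; lia.
by have := leq_pmulr (code u) n0; lia.
Qed.

Lemma code_size_lt u v : size u < size v -> code u < code v.
Proof.
elim/last_ind: v u => // v i IH u; elim/last_ind: u => [_|u j _].
  by rewrite code_rcons addnS.
rewrite !size_rcons ltnS => /IH; rewrite !code_rcons.
move=> uv; have jn := ltn_ord j.
have : (code u).+1 * n <= code v * n by rewrite leq_mul2r uv orbT.
by rewrite mulSn; lia.
Qed.

Lemma code_lt_size u v : code u < code v -> size u <= size v.
Proof. by move=> c; rewrite leqNgt; apply/negP => /code_size_lt; lia. Qed.

Lemma code_inj : injective code.
Proof.
elim/last_ind=> [|u i IH] v; elim/last_ind: v => [|v j _] //; rewrite ?code_rcons.
- by rewrite addnS.
- by rewrite addnS.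
have ltn := ltn_ord i; have ltm := ltn_ord j => e.
have e1 : code u = code v by nia.
have e2 : val i = val j by move: e; rewrite e1 /=; lia.
by rewrite (IH _ e1) (val_inj e2).
Qed.

Lemma code_cat_lt p s u v : code u < code v -> code (p ++ u ++ s) < code (p ++ v ++ s).
Proof.
move=> uv; have sz := code_lt_size uv; rewrite !code_cat !size_cat.
have h1 : code p * n ^ (size u + size s) <= code p * n ^ (size v + size s).
  case: (posnP n) => [n0|n0]; last by rewrite leq_mul2l leq_pexp2l ?orbT //; lia.
  by case: p => [|i]; [rewrite /code | have := ltn_ord i; rewrite {2}n0].
have h2 : 0 < n ^ size s.
  case: s h1 => // i s _; rewrite expn_gt0; have := ltn_ord i; lia.
nia.
Qed.

Definition words_upto N : seq (seq 'I_n) :=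
  flatten [seq [seq val t | t <- enum {: i.-tuple 'I_n}] | i <- iota 0 N.+1].

Lemma mem_words_upto N u : (u \in words_upto N) = (size u <= N).
Proof.
apply/flatten_mapP/idP => [[i]|uN].
  by rewrite mem_iota ltnS => iN /mapP[t _ ->]; rewrite size_tuple.
exists (size u); first by rewrite mem_iota ltnS.
by apply/mapP; exists (in_tuple u); rewrite ?mem_enum.
Qed.

Lemma flatten_nseqSr k u : flatten (nseq k.+1 u) = flatten (nseq k u) ++ u.
Proof. by rewrite -addn1 nseqD flatten_cat /= cats0. Qed.

(** Each exchange of [v] with the copy of [u] on its right raises the code. *)
Lemma code_power_cat u v i j : 0 < i -> code (v ++ u) < code (u ++ v) ->
  code (flatten (nseq j u) ++ v ++ flatten (nseq i u)) <
  code (flatten (nseq (j + i) u) ++ v).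
Proof.
move=> + lt; elim: i j => // i IH j _.
have := code_cat_lt (flatten (nseq j u)) (flatten (nseq i u)) lt.
rewrite -2!catA [flatten (nseq j u) ++ u ++ _]catA -flatten_nseqSr => h.
apply: leq_trans h _; case: (posnP i) => [->|i0].
  by rewrite addn1 cats0.
by rewrite -addSnnS; apply/ltnW/IH.
Qed.

Lemma code_cat_power u v i j : 0 < j -> code (u ++ v) < code (v ++ u) ->
  code (flatten (nseq j u) ++ v ++ flatten (nseq i u)) <
  code (v ++ flatten (nseq (j + i) u)).
Proof.
move=> + lt; elim: j i => // j IH i _.
have := code_cat_lt (flatten (nseq j u)) (flatten (nseq i u)) lt.
rewrite -2!catA [flatten (nseq j u) ++ u ++ _]catA -flatten_nseqSr => h.
apply: leq_trans h _; case: (posnP j) => [->|j0] //.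
by rewrite addSnnS; apply/ltnW/IH.
Qed.

End WordCode.

Import Order.TTheory GRing.Theory Num.Theory.

Local Open Scope classical_set_scope.
Local Open Scope card_scope.
Local Open Scope ring_scope.

(** * Linearization of the minimal polynomial *)

Section Interpolation.
Variables (F : fieldType) (A : falgType F).

(** The Vandermonde matrix of distinct scalars is invertible, so each coefficient is a combination
    of the values. *)
Lemma interpolate_coef (W : {vspace A}) m (s : 'I_m -> A) (a : seq F) :
  uniq a -> size a = m ->
  (forall c, c \in a -> \sum_(i < m) c ^+ i *: s i \in W) -> forall i, s i \in W.
Proof.
move=> ua sa Wa i0.
pose V := Vandermonde m (\row_(j < m) a`_j).
have uV : V \in unitmx.
  rewrite unitmxE det_Vandermonde unitfE; apply/prodf_neq0 => i _.
  apply/prodf_neq0 => j ij; rewrite !mxE subr_eq0 nth_uniq ?sa //.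
  by rewrite gtn_eqF.
have -> : s i0 = \sum_j invmx V j i0 *: \sum_(i < m) a`_j ^+ i *: s i.
  under eq_bigr do rewrite scaler_sumr; rewrite exchange_big /=.
  rewrite (bigD1 i0) //= [X in _ + X]big1 ?addr0 => [|i ii0].
    under eq_bigr do rewrite scalerA; rewrite -scaler_suml.
    have /matrixP/(_ i0 i0) := mulmxV uV; rewrite !mxE eqxx mulr1n => e.
    rewrite -[LHS]scale1r -{1}e; congr (_ *: _).
    by apply: eq_bigr => j _; rewrite !mxE mulrC.
  under eq_bigr do rewrite scalerA; rewrite -scaler_suml.
  have /matrixP/(_ i i0) := mulmxV uV; rewrite !mxE (negbTE ii0) mulr0n => e.
  apply/eqP; rewrite scaler_eq0; apply/orP; left; apply/eqP; rewrite -[RHS]e.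
  by apply: eq_bigr => j _; rewrite !mxE mulrC.
by apply: memv_suml => j _; apply/memvZ/Wa/mem_nth; rewrite sa.
Qed.

(** The linear term of a non-commutative power, with ['X] as a central variable. *)
Lemma coef1_exprD (x y : A) m :
  ((x%:P + y *: 'X) ^+ m)`_1 = \sum_(i < m) x ^+ i * y * x ^+ (m.-1 - i).
Proof.
have c0 k : ((x%:P + y *: 'X) ^+ k)`_0 = x ^+ k.
  elim: k => [|k IH]; first by rewrite coef1.
  by rewrite !exprS coef0M IH coefD coefC coefZ coefX mulr0 addr0.
elim: m => [|m IH]; first by rewrite coef1 big_ord0.
rewrite exprS coefM big_ord_recl big_ord1 /= !subn0 subnn c0 IH.
rewrite !coefD !coefC !coefZ !coefX /= mulr0 mulr1 addr0 add0r addrC.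
rewrite big_ord_recl expr0 mul1r subn0 mulr_sumr; congr (_ + _).
apply: eq_bigr => i _; rewrite lift0 exprS !mulrA; congr (_ * x ^+ _).
have := ltn_ord i; lia.
Qed.

Lemma interpolate_expr (W : {vspace A}) (x y : A) m (a : seq F) :
  uniq a -> size a = m.+1 -> (0 < m)%N ->
  (forall c, (x + c *: y) ^+ m \in W) ->
  \sum_(i < m) x ^+ i * y * x ^+ (m.-1 - i) \in W.
Proof.
move=> ua sa m0 Wc; rewrite -coef1_exprD; set p := _ ^+ m.
have sp : (size p <= m.+1)%N.
  have s1 : (size (x%:P + y *: 'X)%R <= 2)%N.
    rewrite (leq_trans (size_polyD _ _)) // geq_max (leq_trans (size_polyC_leq1 _)) //.
    by rewrite (leq_trans (size_scale_leq _ _)) ?size_polyX.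
  apply: leq_trans (size_poly_exp_leq _ _) _.
  by have := leq_mul s1 (leqnn m); lia.
have ev c : \sum_(i < m.+1) c ^+ i *: p`_i = (x + c *: y) ^+ m.
  (* Scalars are central, so evaluation at them is multiplicative. *)
  have cc (q : {poly A}) : comm_poly q (c%:A).
    by rewrite /comm_poly mulr_algl mulr_algr.
  have <- : p.[c%:A] = (x + c *: y) ^+ m.
    rewrite /p; elim: (m) => [|k IH]; first by rewrite hornerC.
    rewrite !exprS hornerM_comm // IH hornerD hornerC hornerZ hornerX.
    by rewrite mulr_algr.
  rewrite (horner_coef_wide _ sp); apply: eq_bigr => i _.
  by rewrite exprZn expr1n mulr_algr.
have i1 : (1 < m.+1)%N by [].
rewrite -[1%N]/(val (Ordinal i1)).
by apply: (interpolate_coef (s := fun i => p`_i) ua sa) => c _; rewrite ev.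
Qed.

Lemma expr_max_deg (W : {vspace A}) (a : A) :
  (forall i, (i < max_deg A)%N -> a ^+ i \in W) -> a ^+ max_deg A \in W.
Proof.
set m := max_deg A => aW.
have dm : (deg a <= m)%N.
  by rewrite /m /max_deg; case: ex_maxnP => k _; apply; apply/asboolP; exists a.
have [pm pa _] := min_polyP a.
set p := min_poly a in pm pa.
have sp : size p = (deg a).+1 by rewrite prednK // size_poly_gt0 monic_neq0.
(* The extra power of ['X] raises the degree to [m], the same exponent for all elements. *)
pose q := p * 'X^(m - deg a).
have qm : q \is monic by rewrite monicMl ?monicXn.
have sq : size q = m.+1.
  by rewrite size_Mmonic ?monic_neq0 ?monicXn // size_polyXn sp; lia.
have qa : horner_alg a q = 0 by rewrite rmorphM /= pa mul0r.
have e : \sum_(i < m.+1) q`_i *: a ^+ i = 0.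
  rewrite -[RHS]qa [in RHS](_ : q = \poly_(i < m.+1) q`_i); last by rewrite -sq coefK.
  rewrite poly_def raddf_sum /=; apply: eq_bigr => i _.
  by rewrite linearZ /= rmorphXn /= horner_algX mulr_algl.
move: e; rewrite big_ord_recr /=.
have -> : q`_m = 1 by have /monicP := qm; rewrite lead_coefE sq.
rewrite scale1r addrC => /eqP; rewrite addr_eq0 => /eqP ->.
by rewrite memvN; apply: memv_suml => i _; apply/memvZ/aW.
Qed.

End Interpolation.

(** * Normal words *)

Section NormalWords.
Variables (F : fieldType) (A : falgType F) (n : nat) (x : 'I_n -> A).
Implicit Types u v w : seq 'I_n.

Definition ev u := \prod_(i <- u) x i.

Lemma ev_cat u v : ev (u ++ v) = ev u * ev v.
Proof. exact: big_cat. Qed.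

Lemma ev_nseq k u : ev (flatten (nseq k u)) = ev u ^+ k.
Proof. by elim: k => [|k IH]; rewrite ?exprS /= ?ev_cat ?IH // /ev big_nil. Qed.

Definition short N : {vspace A} := <<[seq ev u | u <- words_upto n N]>>%VS.

(* A word is no longer than its code, so the list below contains every word of
   code less than c. *)
Definition below c : {vspace A} :=
  <<[seq ev u | u <- words_upto n c & (code u < c)%N]>>%VS.

Lemma mem_short N u : (size u <= N)%N -> ev u \in short N.
Proof. by move=> uN; apply/memv_span/map_f; rewrite mem_words_upto. Qed.

Lemma shortP N (W : {vspace A}) :
  (forall u, (size u <= N)%N -> ev u \in W) -> (short N <= W)%VS.
Proof.
by move=> uW; apply/span_subvP => a /mapP[u]; rewrite mem_words_upto => uN ->; apply: uW.
Qed.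

Lemma mem_below c u : (code u < c)%N -> ev u \in below c.
Proof.
move=> uc; apply/memv_span/map_f; rewrite mem_filter uc mem_words_upto.
exact/ltnW/(leq_ltn_trans (size_le_code u)).
Qed.

Lemma belowP c (W : {vspace A}) :
  (forall u, (code u < c)%N -> ev u \in W) -> (below c <= W)%VS.
Proof.
move=> uW; apply/span_subvP => a /mapP[u]; rewrite mem_filter => /andP[uc _] ->.
exact: uW.
Qed.

Lemma short_sub_below N v : (N < size v)%N -> (short N <= below (code v))%VS.
Proof. by move=> Nv; apply: shortP => u uN; apply/mem_below/code_size_lt/(leq_ltn_trans uN). Qed.

Lemma mul_mem_short u N a : a \in short N -> ev u * a \in short (size u + N).
Proof.
move=> aN; have : (short N <= amull (ev u) @^-1: short (size u + N))%VS.
  apply: shortP => v vN; rewrite -memv_preim lfunE /= -ev_cat mem_short // size_cat.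
  by rewrite leq_add2l.
by move=> /subvP/(_ _ aN); rewrite -memv_preim lfunE.
Qed.

Lemma shortS N M : (N <= M)%N -> (short N <= short M)%VS.
Proof. by move=> NM; apply: shortP => u uN; apply: mem_short; apply: leq_trans NM. Qed.

Lemma expr_short u v c i : (size v <= size u)%N ->
  (ev u + c *: ev v) ^+ i \in short (size u * i).
Proof.
move=> vu; elim: i => [|i IH].
  by have := @mem_short (size u * 0) [::] isT; rewrite /ev big_nil.
rewrite exprS mulrDl mulnS -scalerAl; apply: memvD; first exact: mul_mem_short.
apply/memvZ/(subvP (shortS _)); last exact: mul_mem_short IH.
by rewrite leq_add2r.
Qed.

Definition normal v := ev v \notin below (code v).

(** The order is compatible with concatenation, so multiplying by [ev p] and [ev s] turns a
    reduction of [v] into one of [p ++ v ++ s]. *)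
Lemma normal_factor p v s : normal (p ++ v ++ s) -> normal v.
Proof.
apply: contra => vb; rewrite !ev_cat.
set W := below _.
have : (below (code v) <= amull (ev p) @^-1: (amulr (ev s) @^-1: W))%VS.
  apply: belowP => u uv; rewrite -!memv_preim !lfunE /= -!ev_cat -catA.
  exact/mem_below/code_cat_lt.
by move=> /subvP/(_ _ vb); rewrite -!memv_preim !lfunE /= -mulrA.
Qed.

Lemma normal_free (L : seq (seq 'I_n)) : uniq L -> {in L, forall v, normal v} ->
  (size L <= \dim {:A})%N.
Proof.
(* Listed by decreasing code, each word evaluates outside the span of the later ones. *)
move=> uL nL; pose L' := sort (fun u v => code v <= code u)%N L.
have pL : perm_eq L' L by rewrite perm_sort.
have sL : sorted (fun u v => code v < code u)%N L'.
  have : sorted gtn (map (@code n) L').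
    rewrite gtn_sorted_uniq_geq (map_inj_uniq (@code_inj n)) sort_uniq uL sorted_map.
    by apply: sort_sorted => u v; apply: leq_total.
  by rewrite sorted_map.
suff fr : free (map ev L').
  by rewrite -(perm_size pL) -(size_map ev) -(eqP fr) dimvS ?subvf.
have nL' v : v \in L' -> normal v by rewrite (perm_mem pL) => /nL.
elim: L' sL nL' {pL} => [|v M IH] //=; first by rewrite nil_free.
rewrite path_sortedE => [/andP[/allP vM sM] nM|u v' w /=]; last by lia.
rewrite free_cons IH // => [|u uM]; last by apply: nM; rewrite inE uM orbT.
rewrite andbT; apply: contra (nM v (mem_head _ _)).
by apply/subvP/span_subvP => a /mapP[u uM ->]; apply/mem_below/vM.
Qed.

End NormalWords.

(** * Powers in normal words *)

Lemma flatten_nseq_shift (T : Type) k (c : T) u :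
  flatten (nseq k (c :: u)) ++ [:: c] = c :: flatten (nseq k (rcons u c)).
Proof. by elim: k => //= k IH; rewrite -catA IH cat_rcons. Qed.

Lemma rcons_eq_cons (T : Type) (c : T) u : rcons u c = c :: u -> u = nseq (size u) c.
Proof. by elim: u => //= y u IH [-> /IH e]; rewrite -e. Qed.

Lemma size_flatten_nseq (T : Type) k (u : seq T) :
  size (flatten (nseq k u)) = (size u * k)%N.
Proof. by rewrite size_flatten /shape map_nseq sumn_nseq. Qed.

Lemma uniq_flatten_sizes (T : eqType) (f : nat -> seq (seq T)) N :
  (forall j, uniq (f j)) -> (forall j u, (j < N)%N -> u \in f j -> size u = j) ->
  uniq (flatten [seq f j | j <- iota 0 N]).
Proof.
move=> uf; elim: N => // N IH sf.
rewrite -addn1 iotaD map_cat flatten_cat /= cats0 cat_uniq uf IH ?andbT /=; last first.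
  by move=> j u jN; apply: sf; apply: ltnW.
apply/hasPn => u /sf su; apply/negP => /flatten_mapP[j]; rewrite mem_iota /= => jN uj.
by have := su (ltnSn _); rewrite (sf j) //; lia.
Qed.

Section Bound.
Variables (F : fieldType) (A : falgType F) (n : nat) (x : 'I_n -> A).
Variable a : seq F.
Hypotheses (m1 : (1 < max_deg A)%N) (ua : uniq a) (sa : size a = (max_deg A).+1).
Implicit Types u v w : seq 'I_n.

Let m' := (max_deg A).-1.

Let m'S : max_deg A = m'.+1.
Proof. by rewrite prednK // ltnW. Qed.

(** The powers of [ev u + d *: ev [:: c]] below [max_deg A] lie in this span, hence so does the
    power [max_deg A]; the sum is its coefficient of [d]. *)
Lemma periodic_sum_short c u : (0 < size u)%N ->
  \sum_(i < m'.+1) ev x (flatten (nseq i u) ++ [:: c] ++ flatten (nseq (m' - i) u))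
    \in short x (size u * m').
Proof.
move=> u0.
have h := @interpolate_expr _ _ (short x (size u * m')) (ev x u) (ev x [:: c]) _ _ ua sa.
rewrite m'S in h.
rewrite (eq_bigr (fun i : 'I_m'.+1 => ev x u ^+ i * ev x [:: c] * ev x u ^+ (m' - i))).
  2: by move=> i _; rewrite !ev_cat !ev_nseq mulrA.
apply: h => // d; rewrite -m'S; apply: expr_max_deg => i.
rewrite m'S ltnS => im; apply/(subvP (shortS x _)); last exact: expr_short.
by rewrite leq_mul2l im orbT.
Qed.

Lemma periodic_not_normal c u :
  ~~ normal x (flatten (nseq m' (c :: u)) ++ [:: c]).
Proof.
set v := _ ++ _.
have sv : size v = ((size u).+1 * m').+1 by rewrite size_cat size_flatten_nseq addn1.
have sub : (short x ((size u).+1 * m') <= below x (code v))%VS.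
  by apply: short_sub_below; rewrite sv.
rewrite /normal negbK; case: (ltngtP (code (u ++ [:: c])) (code (c :: u))) => h.
(* With [rcons u c] repeated, [v] is the first term, and moving [c] to the right lowers the code. *)
- have {}h : (code (rcons u c ++ [:: c]) < code ([:: c] ++ rcons u c))%N.
    by have := code_cat_lt [::] [:: c] h; rewrite -cats1.
  have := @periodic_sum_short c (rcons u c); rewrite size_rcons => /(_ isT)/(subvP sub).
  rewrite big_ord_recl subn0 rpredDr /= -?flatten_nseq_shift //.
  apply: rpred_sum => i _; apply: mem_below; rewrite /v flatten_nseq_shift.
  have := @code_cat_power _ (rcons u c) [:: c] (m' - i.+1) i.+1 isT h.
  by rewrite subnKC.
(* With [c :: u] repeated, [v] is the last term, and moving [c] to the left lowers the code. *)
- have {}h : (code ([:: c] ++ (c :: u)) < code ((c :: u) ++ [:: c]))%N.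
    by have := code_cat_lt [:: c] [::] h; rewrite !cats0.
  have := @periodic_sum_short c (c :: u) isT; move=> /(subvP sub).
  rewrite big_ord_recr /= subnn rpredDl //.
  apply: rpred_sum => i _; apply: mem_below; rewrite /v.
  have im : (0 < m' - i)%N by rewrite subn_gt0.
  have := @code_power_cat _ (c :: u) [:: c] (m' - i) i im h.
  by rewrite subnKC // ltnW.
(* Here [v] is a power of the letter [c] with at least [max_deg A] letters. *)
- have uc : u = nseq (size u) c.
    by apply: rcons_eq_cons; rewrite -cats1; apply: code_inj.
  have vE : v = nseq (size v) c.
    rewrite /v uc -[c :: nseq _ _]/(nseq (size u).+1 c) size_cat size_flatten_nseq size_nseq.
    rewrite nseqD; congr (_ ++ _); elim: (m') => [|k IH]; first by rewrite muln0.
    by rewrite mulnS nseqD /= -IH.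
  have mv : (max_deg A <= size v)%N by rewrite sv m'S ltnS leq_pmull.
  apply: contraT => nv.
  have /normal_factor : normal x ([::] ++ nseq (max_deg A) c ++ nseq (size v - max_deg A) c).
    by rewrite -nseqD subnKC //= -vE.
  have evn k : ev x (nseq k c) = x c ^+ k by rewrite /ev big_nseq -Monoid.iteropE.
  rewrite /normal evn => /negP[]; apply: expr_max_deg => i im.
  by rewrite -evn; apply/mem_below/code_size_lt; rewrite !size_nseq.
Qed.

(** Factors of a normal word are normal, and those of different lengths differ. *)
Lemma sum_complexity_le w : normal x w ->
  (\sum_(j < (size w).+1) complexity j w <= \dim {:A})%N.
Proof.
move=> nw; pose L := flatten [seq undup (factors j w) | j <- iota 0 (size w).+1].
have <- : size L = (\sum_(j < (size w).+1) complexity j w)%N.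
  rewrite size_flatten /shape -map_comp sumnE big_map.
  by rewrite -(big_mkord xpredT (fun j => complexity j w)) /index_iota subn0.
apply: (@normal_free _ _ _ x).
  apply: uniq_flatten_sizes => [j|j u jw]; first exact: undup_uniq.
  by rewrite mem_undup; apply: size_factor.
move=> u /flatten_mapP[j _]; rewrite mem_undup => /factorsP[i _ ->].
apply: (@normal_factor _ _ _ x (take i w) _ (drop j (drop i w))).
by rewrite !cat_take_drop.
Qed.

Lemma normal_size_bound k w : normal x w -> (k * m' < size w)%N ->
  (k.+1 * (size w - k).+1 <= \dim {:A})%N.
Proof.
move=> nw; have m'0 : (0 < m')%N by rewrite -ltnS -m'S.
(* The product is symmetric under exchanging [k] and [size w - k]; when [size w < 2 * k] this lowers
   [k], which preserves the hypothesis. *)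
wlog kw : k / (2 * k <= size w)%N => [hw kw|].
  have [/hw/(_ kw)//|wk] := leqP (2 * k) (size w).
  have kl : (k <= size w)%N by have := leq_pmulr k m'0; lia.
  rewrite mulnC; have := hw (size w - k)%N; rewrite subKn //; apply; first by lia.
  by apply: leq_ltn_trans kw; rewrite leq_mul2r; lia.
move=> kmw; rewrite -sum_minn //; apply: leq_trans (sum_complexity_le nw).
(* A [j] violating the termwise bound has complexity at most [j], [k] and [size w - j], which forces
   a periodic factor. *)
apply: leq_sum => j _; rewrite leqNgt; apply/negP.
rewrite !leq_min !ltnS => /andP[/andP[cj ck] cl].
have jw : (j <= size w)%N by rewrite -ltnS.
have [p [c [u [s e]]]] := periodic_factor m'0 kmw jw cj ck cl.
have {}e : w = p ++ (flatten (nseq m' (c :: u)) ++ [:: c]) ++ s by rewrite e -catA.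
by move: nw; rewrite e => /normal_factor; apply/negP/periodic_not_normal.
Qed.

End Bound.

(** * From the length of an algebra to a normal word *)

Lemma uniq_seq_of_card (T : choiceType) N : ~ ([set: T] #<= `I_N) ->
  exists2 s : seq T, uniq s & size s = N.+1.
Proof.
move=> nT; suff H : forall i, (i <= N.+1)%N -> exists2 s : seq T, uniq s & size s = i.
  exact: H.
elim=> [|i IH iN]; first by exists [::].
have [s us ss] := IH (ltnW iN).
have [[y ys]|all_s] := pselect (exists y, y \notin s).
  by exists (y :: s); rewrite /= ?ys ?ss.
(* Otherwise [s] exhausts [T], and [index] injects [T] into [N] elements. *)
have ins y : y \in s by apply: contrapT => /negP ys; apply: all_s; exists y.
case: nT; apply/pcard_leP/injfunPex; exists (fun y => index y s) => [y _|y z _ _ e].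
  by rewrite /= (leq_trans _ (_ : i <= N)%N) // -ss index_mem.
by rewrite -(nth_index y (ins y)) e nth_index.
Qed.

(** Minimality of the length leaves a product of that many elements of [S] outside the span [W] of
    the shorter products; the least such word is normal. *)
Lemma length_witness (F : fieldType) (A : falgType F) (S : set A) : (0 < set_length S)%N ->
  exists n (x : 'I_n -> A) w, normal x w /\ size w = set_length S.
Proof.
rewrite /set_length; case: ex_minnP => -[//|l] /asboolP Sl minl _.
have [W0 _ WE] := lin_span_vspace (words S l); set W := <<W0>>%VS in WE.
have [w0 [sw0 wS w0W]] : exists w0 : seq A,
    [/\ (size w0 <= l.+1)%N, [set` w0] `<=` S & \prod_(a <- w0) a \notin W].
  apply: contrapT => nw; suff : (l.+1 <= l)%N by rewrite ltnn.
  apply/minl/asboolP; rewrite Sl; apply/seteqP; split; last exact: LspanS.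
  rewrite [X in _ `<=` X]WE; apply: lin_span_sub => _ [w [sw wS ->]].
  by apply: contrapT => /negP wW; apply: nw; exists w.
have shortW w : (size w <= l)%N -> [set` w] `<=` S -> \prod_(a <- w) a \in W.
  move=> wl wS'; suff : [set` W] (\prod_(a <- w) a) by [].
  by rewrite -WE; apply: sub_lin_span; exists w.
have sw0' : size w0 = l.+1.
  apply/eqP; rewrite eqn_leq sw0 ltnNge; apply/negP => wl.
  by move: w0W; rewrite shortW.
(* One letter per position of [w0] gives a finite alphabet even for infinite [S]; distinct letters
   may have equal values. *)
pose x (i : 'I_l.+1) := w0`_i.
have xS u : [set` [seq x i | i <- u]] `<=` S.
  by move=> _ /mapP[i _ ->]; apply: wS; rewrite /= mem_nth // sw0'.
have evE u : ev x u = \prod_(a <- [seq x i | i <- u]) a by rewrite big_map.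
pose P c := [exists w : l.+1.-tuple 'I_l.+1, (ev x w \notin W) && (code w == c)].
have exP : exists c, P c.
  exists (code (ord_tuple l.+1)); apply/existsP; exists (ord_tuple l.+1).
  rewrite eqxx andbT evE val_ord_tuple.
  suff -> : [seq x i | i <- enum 'I_l.+1] = w0 by [].
  apply: (@eq_from_nth _ 0) => [|i]; rewrite size_map size_enum_ord // => il.
  by rewrite (nth_map ord0) ?size_enum_ord // /x nth_enum_ord.
case: (ex_minnP exP) => c /existsP[w /andP[wW /eqP <-]] minc.
exists l.+1, x, w; split; last exact: size_tuple.
(* A word of smaller code evaluates into [W]: either it is shorter, or it has the same length and
   the minimality of the code applies. *)
apply: contra wW; apply/subvP/belowP => u uw.
have := code_lt_size uw; rewrite size_tuple leq_eqVlt => /orP[/eqP su|su]; last first.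
  by rewrite evE shortW // size_map.
apply: contraT => uW; suff : (code w <= code u)%N by rewrite leqNgt uw.
apply: minc; apply/existsP; exists (tcast su (in_tuple u)).
by rewrite val_tcast uW eqxx.
Qed.

Theorem theorem7p7 (F : fieldType) (A : falgType F)
    (hm : (1 < max_deg A)%N)
    (hF : ~ ([set: F] #<= `I_(max_deg A)))
    (k : nat) :
  ((alg_length A)%:R : rat) <=
    Num.max (k%:R * ((max_deg A)%:R - 1))
            ((\dim {:A})%:R / (k%:R + 1) + k%:R - 1).
Proof.
have [a ua sa] := uniq_seq_of_card hF.
rewrite /alg_length; case: ex_maxnP => l /asboolP[S _ lS] _.
have m1 : (max_deg A)%:R - 1 = (max_deg A).-1%:R :> rat.
  by rewrite -(natrB _ (ltnW hm)) subn1.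
(* When [l] exceeds [k(m - 1)], the count [(k + 1)(l - k + 1) <= d] rearranges to the second
   bound. *)
rewrite le_max m1 -natrM ler_nat; case: leqP => //= kl.
have [|n [x [w [nw sw]]]] := @length_witness F A S; first by rewrite lS; apply: leq_ltn_trans kl.
rewrite lS in sw.
have := normal_size_bound hm ua sa nw (k := k); rewrite sw => /(_ kl).
have m0 : (0 < (max_deg A).-1)%N by rewrite -ltnS prednK // ltnW.
(* This makes the truncated [l - k] agree with the rational difference. *)
have kl' : (k <= l)%N := leq_trans (leq_pmulr k m0) (ltnW kl).
rewrite -(ler_nat rat) natrM -[(l - k).+1]addn1 natrD natrB // -addn1 natrD => h.
have k0 : 0 < k%:R + 1 :> rat by rewrite natr1 ltr0Sn.
rewrite -lerBlDr -lerBlDr ler_pdivlMr // mulrC.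
by apply: le_trans h; rewrite opprK addrAC.
Qed.
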